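(* Let $\mathcal{A}$ be a nonzero $C^*$-algebra and let $x$ and $y$ be two elements in a pre-Hilbert $\mathcal{A}$-module $\mathscr{E}$ such that $\Re(\langle x,y\rangle)\le 0$. The following conditions are equivalent: (i) $\|x+y\|^2=\|x\|^2+\|y\|^2$. (ii) $\|x\|^2+\|y\|^2\in V(|x+y|^2)$. (iii) There exists $\varphi\in S_{|x|^2}(\mathcal{A})\cap S_{|y|^2}(\mathcal{A})$ such that $\varphi(\Re(\langle x,y\rangle))=0$.
   Context: A (right) pre-Hilbert $\mathcal{A}$-module $\mathscr{E}$ is a complex linear space that is a right $\mathcal{A}$-module with compatible scalar multiplication, equipped with an $\mathcal{A}$-valued inner product $\langle\cdot,\cdot\rangle$ (conjugate-linear in the first and linear in the second variable) such that $\langle x,x\rangle\ge 0$ with equality iff $x=0$, $\langle x,y\rangle^*=\langle y,x\rangle$, and $\langle x,ya\rangle=\langle x,y\rangle a$. Completeness is not assumed. For $x\in\mathscr{E}$, $|x|:=\langle x,x\rangle^{1/2}\in\mathcal{A}$ and $\|x\|:=\||x|\|_{\mathcal{A}}$. For $a\in\mathcal{A}$, $\Re(a)=\frac12(a+a^* )$, and $\Re(a)\le 0$ means $-\Re(a)$ is a positive element. $S(\mathcal{A})$ is the set of states of $\mathcal{A}$; $V(a)=\{\varphi(a):\varphi\in S(\mathcal{A})\}$ and $S_a(\mathcal{A})=\{\varphi\in S(\mathcal{A}):|\varphi(a)|=\|a\|\}$. *)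

(* Defs.v *)
From HB Require Import structures.
From mathcomp Require Import all_boot all_order all_algebra.
From mathcomp Require Import complex.
From mathcomp Require Import boolp classical_sets reals topology normedtype.

Set Implicit Arguments.
Unset Strict Implicit.
Unset Printing Implicit Defensive.

Import Order.TTheory GRing.Theory Num.Theory.

Local Open Scope classical_set_scope.
Local Open Scope ring_scope.
Local Open Scope complex_scope.

(* C*-algebras need not have a unit, and MathComp rings always have one, so
   the product is a separate operation on a complex Banach space. *)
HB.mixin Record CompleteNormedModule_isCstarAlgebra (R : realType) (A : Type)
    of CompleteNormedModule R[i] A := {
  cmul : A -> A -> A;
  cstar : A -> A;
  cmulA : associative cmul;
  cmulDl : left_distributive cmul +%R;
  cmulDr : right_distributive cmul +%R;
  cmulZl : forall (k : R[i]) (a b : A), cmul (k *: a) b = k *: cmul a b;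
  cmulZr : forall (k : R[i]) (a b : A), cmul a (k *: b) = k *: cmul a b;
  ler_normcM : forall a b : A, `|cmul a b| <= `|a| * `|b|;
  cstarK : involutive cstar;
  cstarD : {morph cstar : a b / a + b};
  cstarZ : forall (k : R[i]) (a : A), cstar (k *: a) = k^* *: cstar a;
  cstarM : forall a b : A, cstar (cmul a b) = cmul (cstar b) (cstar a);
  normc_starM : forall a : A, `|cmul (cstar a) a| = `|a| ^+ 2
}.

#[short(type="cstarAlgType")]
HB.structure Definition CstarAlgebra (R : realType) :=
  {A of CompleteNormedModule R[i] A &
        CompleteNormedModule_isCstarAlgebra R A}.

Declare Scope cstar_scope.
Delimit Scope cstar_scope with cstar.
Notation "a ** b" := (cmul a b)
  (at level 40, left associativity) : cstar_scope.
Notation "a ^**" := (cstar a) (at level 2, format "a ^**") : cstar_scope.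
Local Open Scope cstar_scope.

Section CstarAlgebraDefs.
Variables (R : realType) (A : cstarAlgType R).
Implicit Types (a b : A) (f : {scalar A}).

Definition cpos a : Prop := exists b, a = b^** ** b.

Definition cRe a : A := 2^-1 *: (a + a^**).

(* The positive square root of a positive element; the value is 0 when [a] has
   no positive square root. *)
Definition csqrt a : A := xget 0 [set b | cpos b /\ b ** b = a].

(* Norms take their values in R[i]; upper bounds in R[i] of a nonempty set of
   reals are real, so the supremum below is the usual operator norm. *)
Definition state : set {scalar A} := [set f |
  (forall a, cpos a -> 0 <= f a) /\
  supremums [set `|f a| | a in [set a : A | `|a| <= 1]] 1].

Definition num_range a : set R[i] := [set f a | f in state].

Definition state_at a : set {scalar A} := [set f | state f /\ `|f a| = `|a|].

End CstarAlgebraDefs.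

HB.mixin Record Lmodule_isPreHilbert (R : realType) (A : cstarAlgType R)
    (E : Type) of GRing.Lmodule R[i] E := {
  ract : E -> A -> E;
  inner : E -> E -> A;
  ractDl : forall (x y : E) (a : A), ract (x + y) a = ract x a + ract y a;
  ractDr : forall (x : E) (a b : A), ract x (a + b) = ract x a + ract x b;
  ractM : forall (x : E) (a b : A), ract x (a ** b) = ract (ract x a) b;
  ractZl : forall (k : R[i]) (x : E) (a : A),
    ract (k *: x) a = k *: ract x a;
  ractZr : forall (k : R[i]) (x : E) (a : A),
    ract x (k *: a) = k *: ract x a;
  innerDr : forall x y z : E, inner x (y + z) = inner x y + inner x z;
  innerZr : forall (k : R[i]) (x y : E), inner x (k *: y) = k *: inner x y;
  innerDl : forall x y z : E, inner (x + y) z = inner x z + inner y z;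
  innerZl : forall (k : R[i]) (x y : E), inner (k *: x) y = k^* *: inner x y;
  inner_pos : forall x : E, cpos (inner x x);
  inner_eq0 : forall x : E, inner x x = 0 <-> x = 0;
  inner_star : forall x y : E, (inner x y)^** = inner y x;
  inner_ract : forall (x y : E) (a : A), inner x (ract y a) = inner x y ** a
}.

#[short(type="preHilbertType")]
HB.structure Definition PreHilbert (R : realType) (A : cstarAlgType R) :=
  {E of GRing.Lmodule R[i] E & Lmodule_isPreHilbert R A E}.

Section PreHilbertDefs.
Variables (R : realType) (A : cstarAlgType R) (E : preHilbertType A).
Implicit Type x : E.

Definition habs x : A := csqrt (inner x x : A).

Definition hnorm x : R[i] := `|habs x|.

End PreHilbertDefs.

(* Main.v *)
(* The C*-algebraic input is elementary, without spectral theory. Positivity is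
   encoded by ||t - u|| <= t, read on multiplication operators so as not to need
   a unit; this gives a convex cone. A power iteration gives square roots
   commuting with the commutant, and Arens' trick ||u||^2 <= ||u^2 + v^2|| for
   commuting self-adjoint u, v shows that squares are positive. For positivity
   of b^* b (so that |x| exists), put u = b^* b, v = (u^2)^(1/2), q = v - u and
   d = b q: then d^* d = - q v q is minus a square, which forces d = 0, hence
   q = 0 and u = v >= 0. Norms of positive elements are attained by states: a
   minimal sublinear functional below a suitable majorant is linear.

   Then |x + y|^2 = |x|^2 + |y|^2 + 2 Re<x,y> with Re<x,y> <= 0, and evaluating
   a state on it bounds f(|x + y|^2) by ||x||^2 + ||y||^2, with equality exactly
   when f attains both norms and kills Re<x,y>. *)

From HB Require Import structures.
Require Import Defs.
From mathcomp Require Import all_boot all_order all_algebra.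
From mathcomp Require Import complex ring lra.
From mathcomp Require Import boolp classical_sets reals topology normedtype.
Import Order.TTheory GRing.Theory Num.Theory.
Local Open Scope classical_set_scope.
Local Open Scope ring_scope.
Local Open Scope cstar_scope.
Local Open Scope complex_scope.

Set Implicit Arguments.
Unset Strict Implicit.
Unset Printing Implicit Defensive.

(** * Identities in noncommutative rings *)

Section RingIdentities.
Variable K : pzRingType.
Implicit Types x y z c l k w : K.

Lemma sub_comm_shift l y c : y * c = c * y ->
  l * c - c * l = (l - y) * c - c * (l - y).
Proof. by move=> yc; rewrite mulrBl mulrBr yc opprB addrA subrK. Qed.

Lemma sub_squares_comm x y : x * y = y * x -> (x + y) * (x - y) = x * x - y * y.
Proof. by move=> xy; rewrite mulrDl !mulrBr xy addrA subrK. Qed.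

Lemma sub_squares l y : l * l - y * y = l * (l - y) + (l - y) * y.
Proof. by rewrite mulrBr mulrBl addrA subrK. Qed.

(** For [x] the iterate following [y], this expresses the defect of a limit [l] in the fixed-point
    equation through the errors l - x and l - y, which tend to 0. *)
Lemma iter_defect l w x y : x + x = w + y * y ->
  l + l - (w + l * l) = (l - x) + (l - x) - (l * (l - y) + (l - y) * y).
Proof.
move=> xE; rewrite -sub_squares addrACA -opprD xE opprB [in RHS]addrA.
by rewrite [in RHS]opprD !addrA addrNK opprD addrA.
Qed.

Lemma sqr_one_sub l w : l + l = w + l * l -> (1 - l) * (1 - l) = 1 - w.
Proof.
move=> lE; have -> : w = l + l - l * l by rewrite lE addrK.
by rewrite mulrBl mul1r mulrBr mulr1 -[LHS]addrA -opprD addrA.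
Qed.

Lemma parallelogram x y :
  x * y + x * y = (x + y) * (x + y) - (x - y) * (x - y) - (y * x + y * x).
Proof.
have -> : (x + y) * (x + y) = (x * x + y * y) + (x * y + y * x).
  by rewrite mulrDl !mulrDr [y * x + _]addrC addrACA.
have -> : (x - y) * (x - y) = (x * x + y * y) - (x * y + y * x).
  by rewrite mulrBl !mulrBr opprB addrACA -opprD.
by rewrite opprB [X in _ = X - _]addrC addrA subrK [in RHS]addrACA addrK.
Qed.

End RingIdentities.

(** * Norm and involution *)

Section CstarBasics.
Variables (R : realType) (A : cstarAlgType R).
Implicit Types (a b c : A) (k : R[i]) (r s t : R).

(** Norms take values in [R[i]]; a real-valued copy allows order arithmetic by [lra]. *)
Definition nrm a : R := complex.Re `|a|.

Lemma normE a : `|a| = (nrm a)%:C.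
Proof. by rewrite /nrm RRe_real// ger0_real. Qed.

Lemma nrm_ge0 a : 0 <= nrm a.
Proof. by rewrite -ler0c -normE. Qed.

Lemma ler_nrmD a b : nrm (a + b) <= nrm a + nrm b.
Proof. by have := ler_normD a b; rewrite !normE -rmorphD lecR. Qed.

Lemma nrmN a : nrm (- a) = nrm a.
Proof. by rewrite /nrm normrN. Qed.

Lemma nrm0 : nrm 0 = 0.
Proof. by rewrite /nrm normr0. Qed.

Lemma nrm0_eq0 a : nrm a = 0 -> a = 0.
Proof. by move=> a0; apply/eqP; rewrite -normr_eq0 normE a0. Qed.

Lemma ReM_real k r : complex.Re (k * r%:C) = complex.Re k * r.
Proof. by case: k => x y /=; rewrite mulr0 subr0. Qed.

Lemma nrmZ k a : nrm (k *: a) = complex.Re `|k| * nrm a.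
Proof.
by rewrite {1}/nrm normrZ normE ReM_real.
Qed.

Lemma Re_norm_real r : complex.Re `|r%:C| = `|r|.
Proof. by rewrite normc_def /= expr0n /= addr0 sqrtr_sqr. Qed.

Lemma nrmZr r a : nrm (r%:C *: a) = `|r| * nrm a.
Proof. by rewrite nrmZ Re_norm_real. Qed.

Lemma nrmM a b : nrm (a ** b) <= nrm a * nrm b.
Proof. by have := ler_normcM a b; rewrite !normE -rmorphM lecR. Qed.

Lemma nrm_starM a : nrm (a^** ** a) = nrm a ^+ 2.
Proof. by apply: (@complexI R); rewrite -normE normc_starM normE -rmorphXn. Qed.

Lemma cmul0l a : 0 ** a = 0.
Proof. by apply: (addIr (0 ** a)); rewrite -cmulDl !add0r. Qed.

Lemma cmul0r a : a ** 0 = 0.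
Proof. by apply: (addIr (a ** 0)); rewrite -cmulDr !add0r. Qed.

Lemma cmulNl a b : (- a) ** b = - (a ** b).
Proof. by apply: (addIr (a ** b)); rewrite -cmulDl !addNr cmul0l. Qed.

Lemma cstar0 : (0 : A)^** = 0.
Proof. by apply: (addIr (0^**)); rewrite -cstarD !add0r. Qed.

Lemma cstarN a : (- a)^** = - a^**.
Proof. by apply: (addIr (a^**)); rewrite -cstarD !addNr cstar0. Qed.

Lemma cstarZr r a : (r%:C *: a)^** = r%:C *: a^**.
Proof. by rewrite cstarZ conj_Creal//; apply/complex_realP; exists r. Qed.

(** The C*-identity gives ||b||^2 <= ||b^*|| ||b||; using it at a and at a^* yields both
    inequalities. *)
Lemma nrm_star a : nrm a^** = nrm a.
Proof.
suff le_star b : nrm b <= nrm b^**.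
  by apply/eqP; rewrite eq_le le_star andbT; have := le_star a^**; rewrite cstarK.
have := nrmM b^** b; rewrite nrm_starM expr2.
have [->|b0] := eqVneq (nrm b) 0; first by rewrite nrm_ge0.
by rewrite ler_pM2r// lt_def b0 nrm_ge0.
Qed.

End CstarBasics.

(* Pairs with a real first component suffice: every adjoined scalar
   below is real. *)
Definition unitization (R : realType) (A : cstarAlgType R) : Type := (R * A)%type.

(** * The real unitization and its action on A *)

Section Unitization.
Variables (R : realType) (A : cstarAlgType R).
Local Notation U := (unitization A).
Implicit Types (a b z : A) (r s t : R) (u v w : U).

HB.instance Definition _ := GRing.Zmodule.on U.

Definition uone : U := (1, 0).
Definition umul u v : U :=
  (u.1 * v.1, u.1%:C *: v.2 + v.1%:C *: u.2 + u.2 ** v.2).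
Definition uscale r u : U := (r * u.1, r%:C *: u.2).

Fact umulA : associative umul.
Proof.
move=> [r a] [s b] [t c]; rewrite /umul /=; congr pair; first by rewrite mulrA.
rewrite !cmulDl !cmulDr !scalerDr !cmulZl !cmulZr !scalerA !rmorphM cmulA.
rewrite [t%:C * r%:C]mulrC [t%:C * s%:C]mulrC -!addrA; do 2 congr (_ + _).
rewrite [LHS]addrCA; congr (_ + _).
by rewrite [X in _ + X = _]addrCA [LHS]addrCA; congr (_ + (_ + _)); rewrite addrCA.
Qed.

Fact umul1l : left_id uone umul.
Proof. by move=> [r a]; rewrite /umul /= mul1r scale1r scaler0 addr0 cmul0l addr0. Qed.

Fact umul1r : right_id uone umul.
Proof. by move=> [r a]; rewrite /umul /= mulr1 scale1r scaler0 add0r cmul0r addr0. Qed.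

Fact umulDl : left_distributive umul +%R.
Proof.
move=> [r a] [s b] [t c]; rewrite /umul /=; congr pair; first by rewrite mulrDl.
rewrite /= rmorphD scalerDl scalerDr cmulDl.
by rewrite [RHS]addrACA; congr (_ + _); rewrite [RHS]addrACA.
Qed.

Fact uone_neq0 : uone != 0.
Proof. by apply/eqP => -[/eqP]; rewrite oner_eq0. Qed.

Fact umulDr : right_distributive umul +%R.
Proof.
move=> [r a] [s b] [t c]; rewrite /umul /=; congr pair; first by rewrite mulrDr.
rewrite /= rmorphD scalerDl scalerDr cmulDr.
by rewrite [RHS]addrACA; congr (_ + _); rewrite [RHS]addrACA.
Qed.

HB.instance Definition _ :=
  GRing.Zmodule_isNzRing.Build U umulA umul1l umul1r umulDl umulDr uone_neq0.

Fact uscaleA r s u : uscale r (uscale s u) = uscale (r * s) u.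
Proof. by rewrite /uscale /= mulrA scalerA rmorphM. Qed.

Fact uscale1 : left_id 1 uscale.
Proof. by move=> [r a]; rewrite /uscale /= mul1r scale1r. Qed.

Fact uscaleDr : right_distributive uscale +%R.
Proof. by move=> r u v; rewrite /uscale mulrDr scalerDr. Qed.

Fact uscaleDl u : {morph uscale^~ u : r s / r + s}.
Proof. by move=> r s; rewrite /uscale mulrDl rmorphD scalerDl. Qed.

HB.instance Definition _ := GRing.Zmodule_isLmodule.Build R U
  uscaleA uscale1 uscaleDr uscaleDl.

Fact uscaleAl r u v : r *: (u * v) = (r *: u) * v.
Proof.
rewrite [LHS]/(uscale _ _) [RHS]/(umul _ _) /uscale /umul /=; congr pair.
  by rewrite mulrA.
by rewrite !scalerDr cmulZl !scalerA !rmorphM [v.1%:C * _]mulrC.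
Qed.

HB.instance Definition _ := GRing.Lmodule_isLalgebra.Build R U uscaleAl.

Fact uscaleAr r u v : r *: (u * v) = u * (r *: v).
Proof.
rewrite [LHS]/(uscale _ _) [RHS]/(umul _ _) /uscale /umul /=; congr pair.
  by rewrite mulrCA.
by rewrite !scalerDr cmulZr !scalerA !rmorphM [u.1%:C * _]mulrC.
Qed.

HB.instance Definition _ := GRing.Lalgebra_isAlgebra.Build R U uscaleAr.

Definition ustar u : U := (u.1, u.2^**).
(** Left multiplication by [u] in the unitization, restricted to A. *)
Definition uact u z : A := u.1%:C *: z + u.2 ** z.
Definition uin a : U := (0, a).

Lemma ustarD : {morph ustar : u v / u + v}.
Proof. by move=> u v; rewrite /ustar /= cstarD. Qed.

Lemma ustarN : {morph ustar : u / - u}.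
Proof. by move=> u; rewrite /ustar /= cstarN. Qed.

Lemma ustarB : {morph ustar : u v / u - v}.
Proof. by move=> u v; rewrite ustarD ustarN. Qed.

Lemma ustarM u v : ustar (u * v) = ustar v * ustar u.
Proof.
rewrite /ustar [RHS]/(umul _ _) /umul /= !cstarD cstarM !cstarZr mulrC.
by congr pair; rewrite [X in X + _ = _]addrC.
Qed.

Lemma ustarZ r u : ustar (r *: u) = r *: ustar u.
Proof. by rewrite /ustar [RHS]/(uscale _ _) /uscale /= cstarZr. Qed.

Lemma ustar1 : ustar 1 = 1.
Proof. by rewrite /ustar /= cstar0. Qed.

Lemma ustarK : involutive ustar.
Proof. by move=> [r a]; rewrite /ustar /= cstarK. Qed.

Lemma uinD : {morph uin : a b / a + b}.
Proof. by move=> a b; congr pair; rewrite addr0. Qed.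

Lemma uinN : {morph uin : a / - a}.
Proof. by move=> a; congr pair; rewrite oppr0. Qed.

Lemma uinM a b : uin (a ** b) = uin a * uin b.
Proof.
by rewrite [RHS]/(umul _ _) /umul /= mul0r !scale0r !add0r.
Qed.

Lemma uinZ r a : uin (r%:C *: a) = r *: uin a.
Proof. by rewrite [RHS]/(uscale _ _) /uscale /= mulr0. Qed.

Lemma uin_star a : uin a^** = ustar (uin a).
Proof. by []. Qed.

Lemma uin_inj : injective uin.
Proof. by move=> a b []. Qed.

Lemma uactD u v z : uact (u + v) z = uact u z + uact v z.
Proof. by rewrite /uact /= rmorphD scalerDl cmulDl addrACA. Qed.

Lemma uactN u z : uact (- u) z = - uact u z.
Proof. by rewrite /uact /= rmorphN scaleNr cmulNl opprD. Qed.

Lemma uact0 z : uact 0 z = 0.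
Proof. by rewrite -(subrr (0 : U)) uactD uactN subrr. Qed.

Lemma uactZ r u z : uact (r *: u) z = r%:C *: uact u z.
Proof. by rewrite /uact /= rmorphM -scalerA cmulZl scalerDr. Qed.

Lemma uact1 z : uact 1 z = z.
Proof. by rewrite /uact /= scale1r cmul0l addr0. Qed.

Lemma uactM u v z : uact (u * v) z = uact u (uact v z).
Proof.
rewrite /uact /= rmorphM !cmulDl !cmulDr !scalerDr !cmulZl !cmulZr scalerA cmulA.
by rewrite !addrA.
Qed.

Lemma uact_in a z : uact (uin a) z = a ** z.
Proof. by rewrite /uact scale0r add0r. Qed.

(* [u^*] is the adjoint of [u] for the A-valued inner product of A. *)
Lemma uact_adj u z z' : (uact u z)^** ** z' = z^** ** uact (ustar u) z'.
Proof. by rewrite /uact cstarD cstarM cstarZr cmulDl cmulDr cmulZl cmulZr cmulA. Qed.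

End Unitization.

Lemma cauchy_seq_cvg (K : numFieldType) (V : completeNormedModType K)
    (x : nat -> V) :
  (forall e : K, 0 < e -> exists n, forall m, (n <= m)%N -> `|x m - x n| < e) ->
  exists l, forall e : K, 0 < e ->
    exists N, forall m, (N <= m)%N -> `|l - x m| < e.
Proof.
move=> xcauchy.
have /cauchy_cvgP /cvg_ex[l xl] : cauchy (x @ \oo).
  apply/cauchy_exP => e e0; have [n xn] := xcauchy e e0.
  exists (x n); exists n => // m nm /=.
  by rewrite -ball_normE /= distrC xn.
exists l => e e0; move/cvgrPdist_lt: xl => /(_ e e0) [N _ xN].
by exists N => m Nm; apply: xN.
Qed.

(** * Bounds of multiplication operators *)

Section Bounds.
Variables (R : realType) (A : cstarAlgType R).
Local Notation U := (unitization A).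
Implicit Types (a b z : A) (r s t M N e : R) (u v w : U).

(* The action alone is not faithful when A has a unit, hence the extra bound on
   the scalar part. *)
Definition ubd u M := `|u.1| <= M /\ forall z, nrm (uact u z) <= M * nrm z.

Lemma ubd_ge0 u M : ubd u M -> 0 <= M.
Proof. by case=> u1 _; apply: le_trans u1. Qed.

Lemma ubd_le u M N : M <= N -> ubd u M -> ubd u N.
Proof.
move=> MN [u1 uz]; split; first exact: le_trans MN.
by move=> z; apply: (le_trans (uz z)); rewrite ler_wpM2r ?nrm_ge0.
Qed.

Lemma ubdD u v M N : ubd u M -> ubd v N -> ubd (u + v) (M + N).
Proof.
move=> [u1 uz] [v1 vz]; split; first by rewrite (le_trans (ler_normD _ _))// lerD.
by move=> z; rewrite uactD mulrDl (le_trans (ler_nrmD _ _))// lerD.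
Qed.

Lemma ubdN u M : ubd u M -> ubd (- u) M.
Proof. by move=> [u1 uz]; split=> [|z]; rewrite ?normrN// uactN nrmN. Qed.

Lemma ubdB u v M N : ubd u M -> ubd v N -> ubd (u - v) (M + N).
Proof. by move=> uM /ubdN; apply: ubdD. Qed.

Lemma ubdM u v M N : ubd u M -> ubd v N -> ubd (u * v) (M * N).
Proof.
move=> uM vN; have M0 := ubd_ge0 uM; have [[u1 uz] [v1 vz]] := (uM, vN).
split; first by rewrite /= normrM ler_pM.
by move=> z; rewrite uactM (le_trans (uz _))// -mulrA ler_wpM2l.
Qed.

Lemma ubdZ r u M : ubd u M -> ubd (r *: u) (`|r| * M).
Proof.
move=> [u1 uz]; split; first by rewrite /= normrM ler_wpM2l.
by move=> z; rewrite uactZ nrmZr -mulrA ler_wpM2l.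
Qed.

Lemma ubd1 : ubd 1 1.
Proof. by split=> [|z]; rewrite /= ?normr1// uact1 mul1r. Qed.

Lemma ubd0 : ubd 0 0.
Proof. by split=> [|z]; rewrite ?normr0// uact0 nrm0 mul0r. Qed.

Lemma ubd_in a M : nrm a <= M -> ubd (uin a) M.
Proof.
move=> aM; split=> [|z]; first by rewrite /= normr0 (le_trans _ aM)// nrm_ge0.
by rewrite uact_in (le_trans (nrmM _ _))// ler_wpM2r// nrm_ge0.
Qed.

Lemma nrm_mulstar a : nrm (a ** a^**) = nrm a ^+ 2.
Proof. by rewrite -{1}[a]cstarK nrm_starM nrm_star. Qed.

(** Tested at a^*, the bound reads ||a||^2 = ||a a^*|| <= M ||a||. *)
Lemma ubd_in_nrm a M : ubd (uin a) M -> nrm a <= M.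
Proof.
move=> aM; have M0 := ubd_ge0 aM; have [_ /(_ a^**)] := aM.
rewrite uact_in nrm_mulstar nrm_star expr2.
have [->//|a0] := eqVneq (nrm a) 0.
by rewrite ler_pM2r// lt_def a0 nrm_ge0.
Qed.

Lemma ubd_ex u : exists2 M, 0 < M & ubd u M.
Proof.
have [r1 a1] := (normr_ge0 u.1, nrm_ge0 u.2).
have : ubd (u.1 *: 1 + uin u.2) (`|u.1| * 1 + nrm u.2).
  by apply: ubdD; [apply/ubdZ/ubd1|apply/ubd_in].
have -> : u.1 *: 1 + uin u.2 = u.
  by case: u {r1 a1} => r a; congr pair; rewrite /= ?mulr1 ?addr0// scaler0 add0r.
(* The extra 1 keeps the bound positive when u = 0. *)
by move=> uM; exists (`|u.1| * 1 + nrm u.2 + 1); [lra|apply: ubd_le uM; lra].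
Qed.

(** Stands in for uniqueness of limits: an equation for a limit is proved by bounding its defect by
    every e > 0. *)
Lemma ubd_small u : (forall e, 0 < e -> ubd u e) -> u = 0.
Proof.
move=> ue; have small r : (forall e, 0 < e -> r <= e) -> r <= 0.
  by move=> re; rewrite leNgt; apply/negP => r0; have := re (r / 2); lra.
have u1 : u.1 = 0.
  by apply/eqP; rewrite -normr_le0; apply: small => e /ue[].
have uE : u = uin u.2 by rewrite [LHS]surjective_pairing u1.
suff -> : u = uin 0 by [].
rewrite uE (@nrm0_eq0 _ _ u.2)//; apply/le_anti; rewrite nrm_ge0 andbT.
by apply: small => e /ue; rewrite uE => /ubd_in_nrm.
Qed.

(** With p = u^* z, ||p||^2 = ||z^* (u p)|| <= ||z|| M ||p||. *)
Lemma ubd_star u M : ubd u M -> ubd (ustar u) M.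
Proof.
move=> uM; have [u1 uz] := uM; split=> // z.
have M0 := ubd_ge0 uM; set p := uact (ustar u) z.
have : nrm p ^+ 2 <= nrm z * (M * nrm p).
  rewrite -nrm_starM {1}/p uact_adj ustarK (le_trans (nrmM _ _))// nrm_star.
  by rewrite ler_wpM2l// nrm_ge0.
have [->|p0] := eqVneq (nrm p) 0; first by rewrite mulr_ge0 ?nrm_ge0.
by rewrite expr2 mulrA ler_pM2r 1?mulrC// lt_def p0 nrm_ge0.
Qed.

(* Arens' trick: u + iv and u - iv have modulus squared u^2 + v^2, and their
   mean is u. *)
Lemma ubd_sum_squares u v M : ustar u = u -> ustar v = v -> u * v = v * u ->
  0 <= M -> ubd (u * u + v * v) (M ^+ 2) -> ubd u M.
Proof.
move=> uS vS uv M0 [w1 wz]; split.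
  rewrite -(@ler_pXn2r _ 2)// ?nnegrE// real_normK ?num_real//.
  apply: le_trans (le_trans (ler_norm _) w1).
  by rewrite -[leRHS]/(u.1 * u.1 + v.1 * v.1) expr2 lerDl -expr2 sqr_ge0.
move=> z; have [q qE] : {q | q = uact v z} by exists (uact v z).
move pE: (uact u z) => p.
have pq : p^** ** q = q^** ** p.
  by rewrite -pE qE !uact_adj uS vS -!uactM uv.
have sqE : z^** ** uact (u * u + v * v) z = p^** ** p + q^** ** q.
  by rewrite uactD !uactM cmulDr -pE qE !uact_adj uS vS.
(* Here k is i or -i. Since p^* q = q^* p, the cross terms of the modulus squared cancel and z^*
   (u^2 + v^2) z remains. *)
have bound (k : R[i]) : k ^+ 2 = -1 -> (k^* )%R = - k -> nrm (p + k *: q) <= M * nrm z.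
  move=> k2 kC.
  rewrite -(@ler_pXn2r _ 2)// ?nnegrE ?nrm_ge0 ?mulr_ge0 ?nrm_ge0//.
  rewrite -nrm_starM.
  have -> : (p + k *: q)^** ** (p + k *: q) = z^** ** uact (u * u + v * v) z.
    rewrite sqE cstarD cstarZ kC !cmulDl !cmulDr !cmulZl !cmulZr -pq scaleNr.
    by rewrite scalerA mulNr -expr2 k2 opprK scale1r addrA addrK.
  rewrite (le_trans (nrmM _ _))// nrm_star exprMn mulrC.
  by rewrite (le_trans (ler_wpM2r _ (wz z))) ?nrm_ge0// -mulrA -expr2.
have b1 := bound _ (sqrCi _) (conjCi _).
have b2 : nrm (p + (- 'i%R) *: q) <= M * nrm z.
  by apply: bound; rewrite ?sqrrN ?sqrCi// rmorphN; congr (- _); exact: conjCi.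
have := le_trans (ler_nrmD _ _) (lerD b1 b2).
rewrite scaleNr addrACA subrr addr0.
have -> : p + p = (2 : R)%:C *: p by rewrite rmorph_nat scaler_nat mulr2n.
rewrite nrmZr ger0_norm//; lra.
Qed.

(** Scalar parts converge in R and vector parts in A; the rate [d] then passes to the limit without
    loss. *)
Lemma ubd_complete (y : nat -> U) (d : nat -> R) :
  (forall n m, (n <= m)%N -> ubd (y m - y n) (d n)) ->
  (forall e, 0 < e -> exists n, d n < e) ->
  exists l, forall n, ubd (l - y n) (d n).
Proof.
move=> yd d0.
have [l1 yl1] : exists l1, forall e, 0 < e ->
    exists k : nat, forall m, (k <= m)%N -> `|l1 - (y m).1| < e.
  apply: (@cauchy_seq_cvg R R^o) => e e0; have [n de] := d0 e e0.
  by exists n => m nm; exact: (le_lt_trans (proj1 (yd n m nm)) de).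
have [l2 yl2] : exists l2, forall e : R[i], 0 < e ->
    exists k : nat, forall m, (k <= m)%N -> `|l2 - (y m).2| < e.
  apply: cauchy_seq_cvg => e e0.
  have e_real : (complex.Re e)%:C = e by rewrite RRe_real ?gtr0_real.
  (* Half of e, because subtracting the scalar part to isolate the component in A costs a second
     [d n]. *)
  have [n de] : exists n, d n < complex.Re e / 2.
    by apply: d0; move: e0; rewrite -{1}e_real ltcR; lra.
  exists n => m nm; rewrite -e_real normE ltcR.
  have ynm := yd n m nm; have [yd1 _] := ynm.
  have : ubd (y m - y n - (y m - y n).1 *: 1) (d n + d n).
    apply: ubdB => //; apply: ubd_le (ubdZ _ ubd1).
    by rewrite mulr1.
  have -> : y m - y n - (y m - y n).1 *: 1 = uin ((y m).2 - (y n).2).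
    by congr pair; rewrite /= ?mulr1 ?subrr// scaler0 subr0.
  by move/ubd_in_nrm; lra.
exists (l1, l2) => n.
have near e : 0 < e -> exists2 m, (n <= m)%N & ubd ((l1, l2) - y m) e.
  move=> e0; have [|N1 y1] := yl1 (e / 2); first lra.
  have [|N2 y2] := yl2 (e / 2)%:C; first by rewrite ltcR; lra.
  exists (maxn n (maxn N1 N2)); first by rewrite leq_maxl.
  set m := maxn _ _.
  have {}y1 := y1 m (leq_trans (leq_maxl _ _) (leq_maxr _ _)).
  have := y2 m (leq_trans (leq_maxr _ _) (leq_maxr _ _)).
  rewrite normE ltcR => {}y2.
  have -> : ((l1, l2) : U) - y m = (l1 - (y m).1) *: 1 + uin (l2 - (y m).2).
    by congr pair; rewrite /= ?mulr1 ?addr0// scaler0 add0r.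
  apply: (@ubd_le _ (`|l1 - (y m).1| * 1 + nrm (l2 - (y m).2))); first lra.
  by apply: ubdD; [apply/ubdZ/ubd1|apply: ubd_in].
have lyn e : 0 < e -> ubd ((l1, l2) - y n) (e + d n).
  move=> /near[m nm lm].
  have -> : ((l1, l2) : U) - y n = ((l1, l2) - y m) + (y m - y n).
    by rewrite addrA subrK.
  by apply: ubdD => //; apply: yd.
have small r s : (forall e, 0 < e -> r <= e + s) -> r <= s.
  move=> re; rewrite leNgt; apply/negP => r0.
  by have := re ((r - s) / 2); lra.
split=> [|z]; first by apply: small => e /lyn[].
have [z0|z0] := eqVneq (nrm z) 0.
  by have [_ /(_ z)] := lyn 1 ltr01; rewrite z0 !mulr0.
have zp : 0 < nrm z by rewrite lt_def z0 nrm_ge0.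
rewrite -ler_pdivrMr//; apply: small => e /lyn[_ /(_ z)].
by rewrite ler_pdivrMr.
Qed.

End Bounds.

(** * Square roots *)

Section SquareRoot.
Variables (R : realType) (A : cstarAlgType R).
Local Notation U := (unitization A).
Implicit Types (a b z : A) (r s t M N e : R) (u v w c : U).

(* With w = 1 - u, the limit y of this iteration solves 2y = w + y^2, that is
   (1 - y)^2 = u. The scalar case w = 1 dominates the general one. *)
Fixpoint sqrt_iter w n : U :=
  if n is m.+1 then 2^-1 *: (w + sqrt_iter w m * sqrt_iter w m) else 0.

Fixpoint eta n : R := if n is m.+1 then (1 + eta m ^+ 2) / 2 else 0.

Lemma eta_bound n : 0 <= eta n <= 1.
Proof. by elim: n => [|n /andP[e0 e1]] /=; [lra|apply/andP; split; nra]. Qed.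

Lemma eta_leS n : eta n <= eta n.+1.
Proof. by have /andP[e0 e1] := eta_bound n; rewrite /=; nra. Qed.

(** The error d = 1 - eta n evolves by d' = d - d^2/2, so 1/d starts at 1 and grows by at least 1/2
    at each step. *)
Lemma eta_cvg n : 1 - eta n <= 2 / n.+2%:R.
Proof.
elim: n => [|n IHn]; first by rewrite /= subr0 divff// pnatr_eq0.
have /andP[e0 e1] := eta_bound n.
have n0 : (0 : R) <= n%:R by exact: ler0n.
have nD (m : nat) : (n + m)%:R = n%:R + m%:R :> R by rewrite natrD.
move: IHn; rewrite !ler_pdivlMr ?ltr0n// -(addn3 n) -(addn2 n) !nD /= => IHn.
have : 0 <= eta n * (2 - (1 - eta n) * (n%:R + 2)).
  by apply: mulr_ge0 => //; lra.
have := sqr_ge0 (1 - eta n); rewrite !expr2; nra.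
Qed.

Lemma eta_lt e : 0 < e -> exists n, 1 - eta n < e.
Proof.
move=> e0; have [n ne] : exists n, 2 / e < n%:R.
  by exists (Num.bound (2 / e)); rewrite archi_boundP// divr_ge0// ltW.
exists n; apply: (le_lt_trans (eta_cvg n)).
by move: ne; rewrite !ltr_pdivrMr ?ltr0n// -(addn2 n) natrD; nra.
Qed.

Lemma sqrt_iter_comm w c n : w * c = c * w ->
  sqrt_iter w n * c = c * sqrt_iter w n.
Proof.
move=> wc; elim: n => [|n IHn] /=; first by rewrite mul0r mulr0.
by rewrite -scalerAl -scalerAr mulrDl mulrDr wc -mulrA IHn mulrA IHn mulrA.
Qed.

Lemma sqrt_iter_star w n : ustar w = w -> ustar (sqrt_iter w n) = sqrt_iter w n.
Proof.
move=> wS; elim: n => [|n IHn] /=; first by rewrite /ustar /= cstar0.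
by rewrite ustarZ ustarD ustarM wS IHn.
Qed.

(** Successive iterates commute, so each increment is half the previous one times the sum of the
    last two iterates. [eta] obeys the same recurrence, and the bounds propagate by induction. *)
Lemma sqrt_iter_bound w n : ubd w 1 ->
  ubd (sqrt_iter w n) (eta n) /\
  ubd (sqrt_iter w n.+1 - sqrt_iter w n) (eta n.+1 - eta n).
Proof.
move=> w1; elim: n => [|n [IHn IHd]].
  split; first exact: ubd0.
  rewrite /= mulr0 addr0 expr0n /= addr0 !subr0 mul1r.
  by have := ubdZ 2^-1 w1; rewrite ger0_norm ?mulr1// invr_ge0.
have IHS : ubd (sqrt_iter w n.+1) (eta n.+1).
  have := ubdD IHd IHn; by rewrite !subrK.
split => //; move: IHS IHd IHn.
have -> : sqrt_iter w n.+2 - sqrt_iter w n.+1 = 2^-1 *: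
    ((sqrt_iter w n.+1 + sqrt_iter w n) * (sqrt_iter w n.+1 - sqrt_iter w n)).
  have step k : sqrt_iter w k.+1 = 2^-1 *: (w + sqrt_iter w k * sqrt_iter w k) by [].
  rewrite sub_squares_comm; last by apply: sqrt_iter_comm; rewrite sqrt_iter_comm.
  rewrite (step n.+1) [in X in _ - X](step n) -scalerBr; congr (_ *: _).
  by rewrite opprD addrACA subrr add0r.
have -> : eta n.+2 - eta n.+1 = 2^-1 *
    ((eta n.+1 + eta n) * (eta n.+1 - eta n)) by rewrite /=; field.
move: (sqrt_iter w n.+1) (eta n.+1) => y s yS yd yn.
have := ubdZ 2^-1 (ubdM (ubdD yS yn) yd).
by rewrite ger0_norm // invr_ge0.
Qed.

Lemma sqrt_iter_cauchy w n m : ubd w 1 -> (n <= m)%N ->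
  ubd (sqrt_iter w m - sqrt_iter w n) (1 - eta n).
Proof.
move=> w1 nm; apply: (@ubd_le _ _ _ (eta m - eta n)).
  by have := eta_bound m; lra.
elim: m nm => [|m IHm].
  by rewrite leqn0 => /eqP->; rewrite !subrr; exact: ubd0.
rewrite leq_eqVlt => /predU1P[<-|]; first by rewrite !subrr; exact: ubd0.
move=> /IHm nm; have [_ md] := sqrt_iter_bound m w1.
by have := ubdD md nm; rewrite !addrA !subrK.
Qed.

(** The root is 1 - l, with l the limit of the iteration for w = 1 - u. Self-adjointness,
    commutation and the fixed-point equation pass to l because each defect is at most a constant
    times 1 - eta n. *)
Lemma unitization_sqrt u : ustar u = u -> ubd (1 - u) 1 ->
  exists k, [/\ ustar k = k, k * k = u, ubd (1 - k) 1 &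
    forall c, u * c = c * u -> k * c = c * k].
Proof.
move=> uS w1; set w := 1 - u; set y := sqrt_iter w.
have [l ly] : exists l, forall n, ubd (l - y n) (1 - eta n).
  by apply: ubd_complete => [n m|]; [apply: sqrt_iter_cauchy|exact: eta_lt].
have wS : ustar w = w by rewrite ustarB ustar1 uS.
have small v M : 0 < M -> (forall n, ubd v (M * (1 - eta n))) -> v = 0.
  move=> M0 vM; apply: ubd_small => e e0.
  have [|n ne] := @eta_lt (e / M); first exact: divr_gt0.
  apply: ubd_le (vM n); rewrite mulrC -ler_pdivlMr//; exact: ltW.
have l1 : ubd l 1 by have := ly 0; rewrite /= !subr0.
have lS : ustar l = l.
  apply/eqP; rewrite -subr_eq0; apply/eqP; apply: (@small _ 2) => // n.
  have -> : ustar l - l = ustar (l - y n) - (l - y n).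
    by rewrite ustarB sqrt_iter_star// opprB addrA subrK.
  by apply: ubd_le (ubdB (ubd_star (ly n)) (ly n)); lra.
have lC c : u * c = c * u -> l * c = c * l.
  move=> uc; have [M M0 cM] := ubd_ex c.
  apply/eqP; rewrite -subr_eq0; apply/eqP; apply: (@small _ (2 * M)) => [|n].
    by rewrite mulr_gt0.
  rewrite (@sub_comm_shift _ l (y n)); last first.
    by apply: sqrt_iter_comm; rewrite mulrBl mulrBr uc mul1r mulr1.
  by apply: ubd_le (ubdB (ubdM (ly n) cM) (ubdM cM (ly n))); lra.
(* The constant 4 counts two errors at n.+1 and two at n, the factors l and y n being bounded by
   1. *)
have lE : l + l = w + l * l.
  apply/eqP; rewrite -subr_eq0; apply/eqP; apply: (@small _ 4) => // n.
  rewrite (@iter_defect _ l w (y n.+1) (y n)); last first.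
    by rewrite [y n.+1]/= -mulr2n -scaler_nat scalerA mulfV ?scale1r// pnatr_eq0.
  have yn1 : ubd (y n) 1.
    by have [yn _] := sqrt_iter_bound n w1; apply: ubd_le yn; case/andP: (eta_bound n).
  have := ubdB (ubdD (ly n.+1) (ly n.+1)) (ubdD (ubdM l1 (ly n)) (ubdM (ly n) yn1)).
  by apply: ubd_le; have := eta_leS n; lra.
exists (1 - l); split.
- by rewrite ustarB ustar1 lS.
- by rewrite (sqr_one_sub lE) opprB addrC subrK.
- by rewrite opprB addrC subrK.
- by move=> c uc; rewrite mulrBl mulrBr mul1r mulr1 lC.
Qed.

End SquareRoot.

(** * Positive elements *)

Section Positivity.
Variables (R : realType) (A : cstarAlgType R).
Local Notation U := (unitization A).
Implicit Types (a b d z : A) (r s t M N e : R) (u v w c h k : U).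

Lemma ubd_alg r : ubd (r%:A : U) `|r|.
Proof. by have := ubdZ r (@ubd1 R A); rewrite mulr1. Qed.

Lemma ustar_alg r : ustar (r%:A : U) = r%:A.
Proof. by rewrite ustarZ ustar1. Qed.

(* The usual criterion ||t - u|| <= t, which makes the positive elements
   visibly a convex cone. *)
Definition upos u := ustar u = u /\ exists2 t, 0 < t & ubd (t%:A - u) t.

Lemma uposD u v : upos u -> upos v -> upos (u + v).
Proof.
move=> [uS [s s0 us]] [vS [t t0 vt]]; split; first by rewrite ustarD uS vS.
exists (s + t); first exact: addr_gt0.
by rewrite scalerDl opprD addrACA; apply: ubdD.
Qed.

Lemma uposZ r u : 0 < r -> upos u -> upos (r *: u).
Proof.
move=> r0 [uS [t t0 ut]]; split; first by rewrite ustarZ uS.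
exists (r * t); first exact: mulr_gt0.
by rewrite -scalerA -scalerBr; have := ubdZ r ut; rewrite gtr0_norm.
Qed.

Lemma upos_sqrt u : upos u -> exists k, [/\ upos k, k * k = u &
  forall c, u * c = c * u -> k * c = c * k].
Proof.
move=> [uS [t t0 ut]].
(* Dividing by t turns ||t - u|| <= t into ||1 - u/t|| <= 1; the root is scaled back by the square
   root of t. *)
have [||k [kS kk k1 kC]] := @unitization_sqrt _ _ (t^-1 *: u).
- by rewrite ustarZ uS.
- have := ubdZ t^-1 ut; rewrite gtr0_norm ?invr_gt0// mulVf ?gt_eqF//.
  by rewrite scalerBr scalerA mulVf ?gt_eqF// scale1r.
have s0 : 0 < Num.sqrt t by rewrite sqrtr_gt0.
exists (Num.sqrt t *: k); split.
- apply: uposZ => //; split=> //; exists 1 => //; by rewrite scale1r.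
- rewrite -scalerAl -scalerAr scalerA kk scalerA -expr2 sqr_sqrtr ?ltW//.
  by rewrite mulfV ?gt_eqF// scale1r.
- move=> c uc; rewrite -scalerAl -scalerAr kC// -scalerAl -scalerAr.
  by rewrite uc.
Qed.

(** For the contraction g = h/M, let k be a root of 1 - g^2 commuting with g. As k^2 + g^2 = 1,
    Arens' trick bounds k by 1, hence M^2 - h^2 = M^2 k^2 by M^2. *)
Lemma ubd_sub_square h M : ustar h = h -> 0 < M -> ubd h M ->
  ubd ((M ^+ 2)%:A - h * h) (M ^+ 2).
Proof.
move=> hS M0 hM; set g := M^-1 *: h.
have gS : ustar g = g by rewrite ustarZ hS.
have g1 : ubd g 1.
  by have := ubdZ M^-1 hM; rewrite gtr0_norm ?invr_gt0// mulVf ?gt_eqF.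
have [||k [kS kk k1 kC]] := @unitization_sqrt _ _ (1 - g * g).
- by rewrite ustarB ustarM ustar1 gS.
- by rewrite opprB addrC subrK -[1]mulr1; apply: ubdM.
have kg : k * g = g * k.
  by apply: kC; rewrite mulrBl mulrBr mul1r mulr1 mulrA.
have {}k1 : ubd k 1.
  apply: (@ubd_sum_squares _ _ k g) => //; rewrite kk subrK expr1n; exact: ubd1.
have : ubd (M ^+ 2 *: (k * k)) (M ^+ 2 * 1).
  rewrite -{2}[M ^+ 2]gtr0_norm ?exprn_gt0//; apply: ubdZ.
  by rewrite -[1]mulr1; apply: ubdM.
have -> : M ^+ 2 *: (k * k) = (M ^+ 2)%:A - h * h.
  rewrite kk scalerBr /g -scalerAl -scalerAr !scalerA.
  by rewrite -mulrA -expr2 exprVn mulfV ?expf_neq0 ?gt_eqF// scale1r.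
by rewrite mulr1.
Qed.

Lemma upos_square h : ustar h = h -> upos (h * h).
Proof.
move=> hS; split; first by rewrite ustarM hS.
have [M M0 hM] := ubd_ex h; exists (M ^+ 2); first exact: exprn_gt0.
exact: ubd_sub_square.
Qed.

Lemma ubd_square h M : ustar h = h -> 0 <= M -> ubd (h * h) (M ^+ 2) -> ubd h M.
Proof.
move=> hS M0 hM; apply: (@ubd_sum_squares _ _ h 0) => //.
- by rewrite /ustar /= cstar0.
- by rewrite mulr0 mul0r.
- by rewrite mulr0 addr0.
Qed.

Lemma sqr_eq0_sa h : ustar h = h -> h * h = 0 -> h = 0.
Proof.
move=> hS hh; apply: ubd_small => e e0; apply: ubd_square => //; first exact: ltW.
by rewrite hh; apply: ubd_le (@ubd0 _ _); rewrite sqr_ge0.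
Qed.

(** Up to sign, [h] and [k] are twice the real and imaginary parts of d. This makes d d^* positive
    once -d^* d is. *)
Lemma mul_star_decomp d : exists h k, [/\ ustar h = h, ustar k = k &
  uin d * ustar (uin d) + uin d * ustar (uin d) =
  h * h + k * k - (ustar (uin d) * uin d + ustar (uin d) * uin d)].
Proof.
exists (uin (d + d^**)), (uin ('i%R *: (d - d^**))); split.
- by rewrite -uin_star cstarD cstarK addrC.
- rewrite -uin_star cstarZ cstarD cstarN cstarK.
  by rewrite (conjCi _ : ('i^* )%R = _) scaleNr -scalerN opprB.
have -> : uin ('i%R *: (d - d^**)) * uin ('i%R *: (d - d^**)) =
    - ((uin d - ustar (uin d)) * (uin d - ustar (uin d))).
  rewrite -uinM cmulZl cmulZr scalerA -expr2 sqrCi scaleN1r uinN uinM.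
  by rewrite uinD uinN.
by rewrite uinD -uin_star; exact: parallelogram.
Qed.

(** This is (s + f)^2 = 4 s f + (s - f)^2 multiplied by f = k^2; with s = r^2 the right side is a
    sum of two squares, as Arens' trick requires. *)
Lemma cubic_identity k r : let f := k * k in let s := r ^+ 2 in
  (s%:A + f) * f * (s%:A + f) = (2 * r) *: f * ((2 * r) *: f) +
    k * (s%:A - f) * (k * (s%:A - f)).
Proof.
move=> f s.
(* Both sides are polynomials in k: [ring] proves the identity in the commutative {poly R}, and
   evaluation at k transports it. *)
have [S SE] : {S : {poly R} | S = s%:P} by exists s%:P.
have [T TE] : {T : {poly R} | T = (2 * r)%:P} by exists (2 * r)%:P.
have : (S + 'X * 'X) * ('X * 'X) * (S + 'X * 'X) =
    T * ('X * 'X) * (T * ('X * 'X)) + 'X * (S - 'X * 'X) * ('X * (S - 'X * 'X)).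
  by rewrite SE TE /s; ring.
move/(congr1 (horner_alg k)).
rewrite !(rmorphD, rmorphM, rmorphN) /= SE TE !horner_algC !horner_algX.
by rewrite !mulr_algl.
Qed.

(** Put r = ||d||, s = r^2, e = d^* d, f = d d^*. Since e = -h^2, s + e = s - h^2 is bounded by s,
    so Z = d (s + e) satisfies ||Z^* Z|| <= s^3. But Z Z^* = (s + f) f (s + f) is (2 r f)^2 plus a
    commuting square, so Arens' trick gives 2 r^3 = ||2 r f|| <= r^3, impossible for r > 0. *)
Lemma neg_square_eq0 d h : ustar h = h -> ustar (uin d) * uin d = - (h * h) ->
  d = 0.
Proof.
move=> hS; set D := uin d; set e := ustar D * D => eE.
set f := D * ustar D.
have fpos : upos f.
  have [x [y [xS yS xy]]] := mul_star_decomp d.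
  (* f + f = x^2 + y^2 - 2 e = x^2 + y^2 + 2 h^2 is a sum of squares. *)
  have -> : f = 2^-1 *: (f + f) by rewrite -mulr2n -scaler_nat scalerA mulVf ?scale1r// pnatr_eq0.
  apply: uposZ; rewrite ?invr_gt0// /f xy -/e eE opprD !opprK.
  by apply: uposD; apply: uposD; apply: upos_square.
have [k [[kS _] kk _]] := upos_sqrt fpos.
have [s0|sN] := eqVneq (nrm d) 0; first exact: nrm0_eq0.
have s0 : 0 < nrm d by rewrite lt_def sN nrm_ge0.
set r := nrm d in sN s0; set s := r ^+ 2.
have eS : ubd e s by rewrite /e -uin_star -uinM; apply: ubd_in; rewrite nrm_starM.
have hr : ubd h r.
  apply: ubd_square => //; first exact: ltW.
  by rewrite -[h * h]opprK -eE; apply: ubdN.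
have seS : ubd (s%:A + e) s by rewrite eE; apply: ubd_sub_square.
pose Z := s *: D + D * e.
have zE : Z = uin (s%:C *: d + d ** (d^** ** d)) by rewrite uinD uinZ !uinM.
have eSa : ustar e = e by rewrite ustarM ustarK.
have fSa : ustar f = f by rewrite ustarM ustarK.
have ZZ : ustar Z * Z = (s%:A + e) * e * (s%:A + e).
  rewrite /Z ustarD ustarZ ustarM eSa -[s *: D]mulr_algr -mulrDr.
  by rewrite -[s *: ustar D]mulr_algl -mulrDl !mulrA.
have ZZ' : Z * ustar Z = (s%:A + f) * f * (s%:A + f).
  have -> : Z = (s%:A + f) * D by rewrite /Z mulrDl mulr_algl -mulrA.
  by rewrite ustarM ustarD ustar_alg fSa !mulrA.
have zn : nrm (s%:C *: d + d ** (d^** ** d)) ^+ 2 <= (r ^+ 3) ^+ 2.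
  rewrite -nrm_starM; apply: ubd_in_nrm; rewrite uinM uin_star -zE ZZ.
  have -> : (r ^+ 3) ^+ 2 = s * s * s by rewrite /s; ring.
  by apply: ubdM => //; apply: ubdM.
have : ubd ((2 * r) *: f) (r ^+ 3).
  apply: (@ubd_sum_squares _ _ _ (k * (s%:A - f))).
  - by rewrite ustarZ fSa.
  - rewrite ustarM ustarB ustar_alg kS fSa -kk mulrBl mulrBr mulr_algl mulr_algr.
    by rewrite mulrA.
  - rewrite -kk -scalerAl -scalerAr; congr (_ *: _).
    by rewrite !(mulrBl, mulrBr) !(mulr_algl, mulr_algr, =^~scalerAl, =^~scalerAr) !mulrA.
  - by rewrite exprn_ge0// ltW.
  - have := cubic_identity k r; rewrite /= kk -/s => <-; rewrite -ZZ' zE -uin_star -uinM.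
    by apply: ubd_in; rewrite nrm_mulstar.
have -> : (2 * r) *: f = uin ((2 * r)%:C *: (d ** d^**)) by rewrite uinZ uinM.
move/ubd_in_nrm; rewrite nrmZr nrm_mulstar -/r ger0_norm; last by rewrite mulr_ge0// ltW.
have r3 : 0 < r ^+ 3 by exact: exprn_gt0.
by rewrite -mulrA -exprS mulr_natl mulr2n gerDl leNgt r3.
Qed.

(** Here q is twice the negative part of u. The root w of v commutes with q, so q v q is the square
    of the self-adjoint q w. *)
Lemma upos_star_mul b : upos (uin (b^** ** b)).
Proof.
set u := uin _.
have uS : ustar u = u by rewrite -uin_star cstarM cstarK.
have [v [vpos vv vC]] := upos_sqrt (upos_square uS).
have [w [[wS _] ww wC]] := upos_sqrt vpos.
have [vS _] := vpos.
have vu : v * u = u * v by apply: vC; rewrite mulrA.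
have wu : w * u = u * w by apply: wC.
have wv : w * v = v * w by apply: wC.
set q := v - u.
have qS : ustar q = q by rewrite ustarB vS uS.
have wq : w * q = q * w by rewrite mulrBr mulrBl wv wu.
have vq : v * q = q * v by rewrite mulrBr mulrBl vu.
have uq : u * q = - (v * q).
  by rewrite /q !mulrBr vv vu opprB.
have qq : q * q = v * q + v * q by rewrite {1}/q mulrBl uq opprK.
have hS : ustar (q * w) = q * w by rewrite ustarM qS wS.
have quq : q * u * q = - (q * w * (q * w)).
  by rewrite -mulrA uq mulrN; congr (- _); rewrite -mulrA [w * (q * w)]mulrA wq -[q * w * w]mulrA ww -vq.
(* q might have a scalar part, but b q lies in A, where [neg_square_eq0] applies. *)
have dE : uin b * q = uin (uin b * q).2 by congr pair; rewrite /= mul0r.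
have d0 : (uin b * q).2 = 0.
  apply: (@neg_square_eq0 _ (q * w)) => //.
  by rewrite -dE ustarM qS -quq /u uinM uin_star !mulrA.
have h0 : q * w = 0.
  apply: sqr_eq0_sa => //; apply: oppr_inj; rewrite -quq oppr0.
  rewrite /u uinM uin_star -{1}qS -!mulrA [uin b * q]dE d0.
  by rewrite (_ : uin 0 = 0)// !mulr0.
have q0 : q = 0.
  apply: sqr_eq0_sa => //; apply: sqr_eq0_sa; first by rewrite ustarM qS.
  have -> : q * q = 0.
    by rewrite qq vq -ww mulrA h0 mul0r addr0.
  by rewrite mul0r.
by move/eqP: q0; rewrite subr_eq0 => /eqP <-.
Qed.

(** The root found in the unitization has a scalar part of square 0, so it lies in A. *)
Lemma upos_in_sqrt a : upos (uin a) -> exists2 b, upos (uin b) & b ** b = a.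
Proof.
move=> /upos_sqrt[[r b] [bpos bb _]].
have r0 : r = 0 by case: bb => /eqP + _; rewrite mulf_eq0 orbb => /eqP.
rewrite {}r0 in bpos bb; exists b => //.
by apply: uin_inj; rewrite uinM.
Qed.

Lemma upos_star a : upos (uin a) -> a^** = a.
Proof. by case=> aS _; apply: uin_inj; rewrite uin_star. Qed.

(** Transfers the cone structure of [upos] to elements of the form b^* b. *)
Lemma cposP a : cpos a <-> upos (uin a).
Proof.
split=> [[b ->]|apos]; first exact: upos_star_mul.
have [b bpos <-] := upos_in_sqrt apos; exists b; by rewrite upos_star.
Qed.

Lemma cposD a b : cpos a -> cpos b -> cpos (a + b).
Proof. by rewrite !cposP uinD; apply: uposD. Qed.

Lemma cposZ r a : 0 < r -> cpos a -> cpos (r%:C *: a).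
Proof. by rewrite !cposP uinZ; apply: uposZ. Qed.

Lemma cpos0 : cpos (0 : A).
Proof. by exists 0; rewrite cmul0r. Qed.

Lemma cpos_star a : cpos a -> a^** = a.
Proof. by rewrite cposP; apply: upos_star. Qed.

Lemma csqrtP a : cpos a -> cpos (csqrt a) /\ csqrt a ** csqrt a = a.
Proof.
move=> /cposP /upos_in_sqrt[b bpos bb].
(* Existence of a positive root excludes the default value 0 of [xget]. *)
have := @xgetPex A 0 [set b | cpos b /\ b ** b = a].
by apply; exists b; split=> //; apply/cposP.
Qed.

(** Otherwise take T strictly between the two norms. T - a = (T - (a + b)) + b is positive, and the
    commuting roots k of a and g of T - a satisfy k^2 + g^2 = T. Arens' trick then gives ||a|| <=
    T. *)
Lemma nrm_le_add a b : cpos a -> cpos b -> nrm a <= nrm (a + b).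
Proof.
move=> apos bpos; rewrite leNgt; apply/negP => ltn.
set t := nrm (a + b) in ltn; pose T := (t + nrm a) / 2.
have T0 : 0 < T by have := nrm_ge0 (a + b); rewrite /T -/t; lra.
have acS : (a + b)^** = a + b by rewrite cpos_star//; apply: cposD.
have gpos : upos (T%:A - uin a).
  have -> : T%:A - uin a = (T%:A - uin (a + b)) + uin b.
    by rewrite uinD opprD addrA subrK.
  apply: uposD; last exact/cposP.
  split; first by rewrite ustarB ustar_alg -uin_star acS.
  exists T => //; rewrite opprB addrC subrK; apply: ubd_in.
  by rewrite -/t /T; lra.
have [g [[gS _] gg gC]] := upos_sqrt gpos.
have [k [[kS _] kk _]] := upos_sqrt (proj1 (cposP a) apos).
have gk : g * k = k * g.
  by apply: gC; rewrite mulrBl mulrBr mulr_algl mulr_algr -kk mulrA.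
have s0 : 0 <= Num.sqrt T by exact: sqrtr_ge0.
have : ubd k (Num.sqrt T).
  apply: (@ubd_sum_squares _ _ _ g) => //.
  rewrite kk gg addrC subrK sqr_sqrtr ?ltW//.
  by have := ubd_alg T; rewrite gtr0_norm.
move=> kb; have := ubdM kb kb; rewrite kk -expr2 sqr_sqrtr ?ltW//.
by move/ubd_in_nrm; rewrite /T; lra.
Qed.

End Positivity.

(** * Linear functionals below sublinear ones *)

Section HahnBanach.
Variables (R : realType) (V : lmodType R).
Implicit Types (p q : V -> R) (x y : V) (s t : R).

Definition sublinear p := (forall x y, p (x + y) <= p x + p y) /\
  (forall t x, 0 < t -> p (t *: x) <= t * p x).

Lemma sublinear0 p : sublinear p -> p 0 = 0.
Proof.
move=> [pD pZ]; have h0 : (0 : R) < 2^-1 by rewrite invr_gt0.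
have := pD 0 0; have := pZ 2^-1 0 h0.
by rewrite addr0 scaler0; lra.
Qed.

Lemma sublinearZ p t x : sublinear p -> 0 <= t -> p (t *: x) = t * p x.
Proof.
move=> ps; have [pD pZ] := ps.
rewrite le_eqVlt => /predU1P[<-|t0]; first by rewrite scale0r mul0r sublinear0.
apply/le_anti; rewrite pZ//= -ler_pdivlMl//.
by rewrite -{1}[x](scalerK (lt0r_neq0 t0)) pZ// invr_gt0.
Qed.

Lemma sublinearN p x : sublinear p -> - p (- x) <= p x.
Proof.
move=> ps; have [pD pZ] := ps.
by have := pD x (- x); rewrite subrr sublinear0//; lra.
Qed.

Lemma sublinear_linear p : sublinear p -> (forall x, p (- x) <= - p x) -> scalar p.
Proof.
move=> ps pN; have [pD pZ] := ps.
have pNE x : p (- x) = - p x.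
  by apply/le_anti; rewrite pN lerNl sublinearN.
have pDE x y : p (x + y) = p x + p y.
  apply/le_anti; rewrite pD/=; have := pD (- x) (- y).
  by rewrite -opprD !pNE; lra.
move=> t x y; rewrite pDE; congr (_ + _).
have [t0|t0] := leP 0 t; first exact: sublinearZ.
by rewrite -[t]opprK scaleNr pNE sublinearZ// ?oppr_ge0 ?ltW// !mulNr.
Qed.

(** One criterion serves for perturbations, infima of chains and the majorant used for states; [m]
    keeps the infima finite. *)
Lemma sublinear_inf (S : V -> set R) (m : V -> R) :
  (forall x, S x !=set0) -> (forall x, lbound (S x) (m x)) ->
  (forall x y u v, S x u -> S y v -> exists2 w, S (x + y) w & w <= u + v) ->
  (forall t x u, 0 < t -> S x u -> exists2 w, S (t *: x) w & w <= t * u) ->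
  sublinear (fun x => inf (S x)).
Proof.
move=> S0 mS SD SZ.
have infle x u : S x u -> inf (S x) <= u by apply: ge_inf; exists (m x); exact: mS.
split=> [x y|t x t0].
  rewrite -lerBlDr; apply: lb_le_inf => // u Su.
  rewrite lerBlDr [u + _]addrC -lerBlDr; apply: lb_le_inf => // v Sv.
  rewrite lerBlDr [v + _]addrC; have [w Sw] := SD _ _ _ _ Su Sv.
  by apply: le_trans; exact: infle.
rewrite -ler_pdivrMl//; apply: lb_le_inf => // u Su.
rewrite ler_pdivrMl//; have [w Sw] := SZ _ _ _ t0 Su.
by apply: le_trans; exact: infle.
Qed.

(** Take q x = inf over t >= 0 of p (x + t x0) - t p x0; t = 1 gives the bound at -x0. For minimal p
    it forces p (- x0) <= - p x0. *)
Lemma sublinear_perturb p x0 : sublinear p -> exists q,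
  [/\ sublinear q, forall x, q x <= p x & q (- x0) <= - p x0].
Proof.
move=> ps; have [pD pZ] := ps.
pose S x := [set p (x + t *: x0) - t * p x0 | t in [set t | 0 <= t]].
have S0 x : S x (p x) by exists 0 => //=; rewrite scale0r mul0r addr0 subr0.
have mS x : lbound (S x) (- p (- x)).
  move=> _ [t /= t0 <-]; rewrite -sublinearZ//.
  by have := pD (x + t *: x0) (- x); rewrite addrAC subrr add0r; lra.
have infle x u : S x u -> inf (S x) <= u by apply: ge_inf; exists (- p (- x)); exact: mS.
exists (fun x => inf (S x)); split=> [|x|]; last 2 first.
- exact: infle.
- apply: infle; exists 1 => //=; by rewrite scale1r addNr sublinear0// mul1r sub0r.
apply: (sublinear_inf (m := fun x => - p (- x))) => //.
- by move=> x; exists (p x).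
- move=> x y _ _ [s /= s0 <-] [t /= t0 <-].
  exists (p (x + y + (s + t) *: x0) - (s + t) * p x0).
    by exists (s + t) => //=; exact: addr_ge0.
  by have := pD (x + s *: x0) (y + t *: x0); rewrite addrACA -scalerDl; lra.
- move=> t x _ t0 [s /= s0 <-].
  exists (p (t *: x + (t * s) *: x0) - t * s * p x0).
    by exists (t * s) => //=; rewrite mulr_ge0// ltW.
  by have := pZ t (x + s *: x0) t0; rewrite scalerDr scalerA; lra.
Qed.

(* A minimal sublinear functional is linear. *)
Theorem sublinear_dominates p : sublinear p ->
  exists f : V -> R, scalar f /\ forall x, f x <= p x.
Proof.
move=> ps; pose T := {q : V -> R | sublinear q /\ forall x, q x <= p x}.
pose mk q (qs : sublinear q) (qp : forall x, q x <= p x) : T := exist _ q (conj qs qp).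
(* The order is reversed, so a maximal element for Zorn's lemma is a minimal functional. *)
pose below (q r : T) := `[< forall x, sval r x <= sval q x >].
have [] := @ZL_preorder T (mk p ps (fun x => lexx (p x))) below.
- by move=> q; apply/asboolP.
- move=> q r s /asboolP qr /asboolP rs; apply/asboolP => x.
  exact: le_trans (rs x) (qr x).
- move=> C Ctot; have [[q0 Cq0]|C0] := pselect (exists q : T, C q); last first.
    exists (mk p ps (fun x => lexx (p x))) => q Cq.
    by exfalso; apply: C0; exists q.
  pose S x := [set sval q x | q in C].
  have mS x : lbound (S x) (- p (- x)).
    move=> _ [[q [qs qp]] Cq <-] /=; apply: le_trans (sublinearN x qs).
    by rewrite lerN2.
  have infle x (q : T) : C q -> inf (S x) <= sval q x.
    by move=> Cq; apply: ge_inf; [exists (- p (- x)); exact: mS|exists q].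
  have Ss : sublinear (fun x => inf (S x)).
    apply: (sublinear_inf (m := fun x => - p (- x))) => //.
    + by move=> x; exists (sval q0 x); exists q0.
    + move=> x y _ _ [q Cq <-] [r Cr <-].
      have [/asboolP le|/asboolP le] := Ctot q r Cq Cr.
        exists (sval r (x + y)); first by exists r.
        have [[rD _] _] := svalP r.
        by apply: le_trans (rD x y) _; rewrite lerD2r.
      exists (sval q (x + y)); first by exists q.
      have [[qD _] _] := svalP q.
      by apply: le_trans (qD x y) _; rewrite lerD2l.
    + move=> t x _ t0 [q Cq <-]; exists (sval q (t *: x)); first by exists q.
      by have [[_ qZ] _] := svalP q; exact: qZ.
  have Sp x : inf (S x) <= p x.
    by apply: le_trans (infle x q0 Cq0) _; have [_] := svalP q0.
  exists (mk _ Ss Sp) => q Cq; apply/asboolP => x /=.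
  exact: infle.
move=> [q [qs qp]] qmin; exists q; split=> //.
apply: sublinear_linear => // x.
have [r [rs rq rx]] := sublinear_perturb x qs.
have rp y : r y <= p y := le_trans (rq y) (qp y).
have /asboolP qr : below (mk r rs rp) (mk q qs qp).
  by apply: qmin; apply/asboolP.
exact: le_trans (qr _) rx.
Qed.

End HahnBanach.

(** An alias of A carries the scaling by R, so that real Hahn-Banach applies beside the complex
    scaling of A. *)
Definition realify (R : realType) (A : cstarAlgType R) : Type := A.

Section Realify.
Variables (R : realType) (A : cstarAlgType R).
Implicit Types (a : A) (r s : R).

HB.instance Definition _ := GRing.Zmodule.on (realify A).

Definition rscale r (a : realify A) : realify A := r%:C *: (a : A).

Fact rscaleA r s a : rscale r (rscale s a) = rscale (r * s) a.
Proof. by rewrite /rscale scalerA rmorphM. Qed.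

Fact rscale1 : left_id 1 rscale.
Proof. by move=> a; rewrite /rscale scale1r. Qed.

Fact rscaleDr : right_distributive rscale +%R.
Proof. by move=> r a b; exact: scalerDr. Qed.

Fact rscaleDl a : {morph rscale^~ a : r s / r + s}.
Proof. by move=> r s; rewrite /rscale rmorphD; exact: scalerDl. Qed.

HB.instance Definition _ := GRing.Zmodule_isLmodule.Build R (realify A)
  rscaleA rscale1 rscaleDr rscaleDl.

End Realify.

(** * States attaining the norm *)

Section States.
Variables (R : realType) (A : cstarAlgType R).
Implicit Types (a b c z : A) (k : R[i]) (r s t : R).

Lemma scalerr_real r s z : r%:C *: (s%:C *: z) = (r * s)%:C *: z.
Proof. by rewrite scalerA rmorphM. Qed.

Lemma cReD a b : cRe (a + b) = cRe a + cRe b.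
Proof. by rewrite /cRe cstarD addrACA scalerDr. Qed.

Lemma scale_half a : 2^-1 *: (a + a) = a.
Proof.
have half : 2^-1 + 2^-1 = 1 :> R[i] by rewrite [RHS]splitr mul1r.
by rewrite scalerDr -scalerDl half scale1r.
Qed.

Lemma two_cRe a : cRe a + cRe a = a + a^**.
Proof. by rewrite /cRe -scalerDr scale_half. Qed.

Lemma half_real : (2^-1 : R[i]) = (2^-1 : R)%:C.
Proof. by rewrite fmorphV rmorph_nat. Qed.

Lemma cReZ r a : cRe (r%:C *: a) = r%:C *: cRe a.
Proof. by rewrite /cRe cstarZr -scalerDr !scalerA mulrC. Qed.

Lemma cRe_sa a : a^** = a -> cRe a = a.
Proof. by move=> aS; rewrite /cRe aS scale_half. Qed.

Lemma cRe_imag a : a^** = a -> cRe ('i%R *: a) = 0.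
Proof.
move=> aS; rewrite /cRe cstarZ aS (conjCi _ : ('i^* )%R = _).
by rewrite scaleNr subrr scaler0.
Qed.

Lemma nrm_cRe a : nrm (cRe a) <= nrm a.
Proof.
rewrite /cRe half_real nrmZr ger0_norm ?invr_ge0//.
have := ler_nrmD a a^**; rewrite nrm_star; lra.
Qed.

Section Majorant.
Variable a : A.

(* Domination by this functional encodes at once positivity (through b),
   contractivity (b = 0, t = 0) and the value nrm a at a (t = 1). *)
Let values z := [set u | exists b t,
  [/\ cpos b, 0 <= t & u = nrm (cRe z + b + t%:C *: a) - t * nrm a]].

Let majorant (z : realify A) : R := inf (values z).

Hypothesis apos : cpos a.

(** Monotonicity of the norm gives t ||a|| <= ||t a + b||, and removing Re z costs at most ||z||. *)
Lemma majorant_lbound z : lbound (values z) (- nrm z).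
Proof.
move=> _ [b [t [bpos t0 ->]]].
have le1 : t * nrm a <= nrm (t%:C *: a + b).
  move: t0; rewrite le_eqVlt => /predU1P[<-|t0]; first by rewrite mul0r nrm_ge0.
  by rewrite -{1}(gtr0_norm t0) -nrmZr; apply: nrm_le_add => //; apply: cposZ.
have -> : cRe z + b + t%:C *: a = cRe z + (t%:C *: a + b).
  by rewrite -addrA [b + _]addrC.
have := ler_nrmD (cRe z + (t%:C *: a + b)) (- cRe z).
by rewrite addrAC subrr add0r nrmN; have := nrm_cRe z; lra.
Qed.

Lemma majorant_le z b t : cpos b -> 0 <= t ->
  majorant z <= nrm (cRe z + b + t%:C *: a) - t * nrm a.
Proof.
move=> bpos t0; apply: ge_inf; last by exists b, t.
by exists (- nrm z); exact: majorant_lbound.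
Qed.

Lemma majorant_sublinear : sublinear majorant.
Proof.
apply: (sublinear_inf (m := fun z : realify A => - nrm (z : A))).
- move=> z; exists (nrm (cRe z + 0 + 0%:C *: a) - 0 * nrm a); exists 0, 0.
  by split => //; exact: cpos0.
- exact: majorant_lbound.
- move=> x y _ _ [b [s [bpos s0 ->]]] [c [t [cp t0 ->]]].
  exists (nrm (cRe ((x : A) + y) + (b + c) + (s + t)%:C *: a) - (s + t) * nrm a).
    exists (b + c), (s + t); split => //; [exact: cposD|exact: addr_ge0].
  have := ler_nrmD (cRe x + b + s%:C *: a) (cRe y + c + t%:C *: a).
  by rewrite addrACA [cRe x + b + (_ + _)]addrACA -cReD -scalerDl -rmorphD; lra.
- move=> t x _ t0 [b [s [bpos s0 ->]]].
  exists (nrm (cRe (t%:C *: (x : A)) + t%:C *: b + (t * s)%:C *: a) - t * s * nrm a).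
    exists (t%:C *: b), (t * s); split => //; [exact: cposZ|].
    by rewrite mulr_ge0// ltW.
  by rewrite -scalerr_real cReZ -!scalerDr nrmZr gtr0_norm// mulrBr mulrA.
Qed.

(** At z = -(b + t a) the argument of the norm vanishes, so phi z <= -t ||a||: t = 0 gives
    positivity, and b = 0, t = 1 gives phi a >= ||a||. Both i b and -i b have real part 0, whence
    phi (i b) = 0. *)
Lemma dominated_functional : exists phi : realify A -> R,
  [/\ scalar phi, forall z : A, phi z <= nrm z,
      forall b : A, cpos b -> 0 <= phi b /\ phi ('i%R *: b) = 0 & phi a = nrm a].
Proof.
have [phi [lin le]] := sublinear_dominates majorant_sublinear.
have phi0 : phi 0 = 0.
  by have := lin (-1) 0 0; rewrite scaler0 addr0 mulN1r addNr.
have phiN (z : A) : phi (- z) = - phi z.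
  by have := lin (-1) z 0; rewrite phi0 scaleN1r !addr0 mulN1r.
have c0 : cRe (0 : A) = 0 by rewrite /cRe cstar0 addr0 scaler0.
have phile (z : A) : phi z <= nrm z.
  apply: le_trans (le z) (le_trans _ (nrm_cRe z)).
  have := majorant_le z (@cpos0 _ _) (lexx 0).
  by rewrite scale0r mul0r !addr0 subr0.
have phi_Re0 (z : A) : cRe z = 0 -> phi z <= 0.
  move=> z0; apply: le_trans (le z) _.
  have := majorant_le z (@cpos0 _ _) (lexx 0).
  by rewrite z0 scale0r mul0r !addr0 subr0 nrm0.
have phi_neg (b : A) t : cpos b -> 0 <= t -> phi (- (b + t%:C *: a)) <= - (t * nrm a).
  move=> bpos t0; apply: le_trans (le _) _.
  have := majorant_le (- (b + t%:C *: a)) bpos t0.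
  rewrite cRe_sa; last by rewrite cstarN cstarD cstarZr !cpos_star.
  by rewrite -addrA addNr nrm0 sub0r.
exists phi; split=> // [b bpos|].
  split.
    have := phi_neg b 0 bpos (lexx 0).
    by rewrite scale0r addr0 phiN mul0r oppr0 oppr_le0.
  have ib : cRe ('i%R *: b) = 0 by apply/cRe_imag/cpos_star.
  apply/le_anti; rewrite phi_Re0//= -oppr_le0 -phiN phi_Re0//.
  by rewrite -scalerN cRe_imag// cstarN cpos_star.
apply/le_anti; rewrite phile/=.
have := phi_neg 0 1 (@cpos0 _ _) ler01.
by rewrite add0r scale1r phiN mul1r lerN2.
Qed.

End Majorant.

(** The usual complexification phi(z) - i phi(i z) of a real-linear functional. *)
Lemma state_of_real_part (phi : realify A -> R) : scalar phi ->
  exists f : {scalar A}, forall z : A, f z = (phi z +i* - phi ('i%R *: z))%C.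
Proof.
move=> lin; pose g (z : A) : R[i] := (phi z +i* - phi ('i%R *: z))%C.
have phi0 : phi 0 = 0.
  by have := lin (-1) 0 0; rewrite scaler0 addr0 mulN1r addNr.
have phiD (x y : A) : phi (x + y) = phi x + phi y.
  by have := lin 1 x y; rewrite scale1r mul1r.
have phiZ r (x : A) : phi (r%:C *: x) = r * phi x.
  by have := lin r x 0; rewrite phi0 !addr0.
have glin : scalar g.
  move=> k x y; rewrite /g.
  have kE (z : A) : k *: z = (complex.Re k)%:C *: z + (complex.Im k)%:C *: ('i%R *: z).
    by rewrite scalerA -scalerDl {1}[k]complexE complexiE mulrC [_ * 'i%R]mulrC.
  have iE (z : A) : 'i%R *: (k *: z) =
      (complex.Re k)%:C *: ('i%R *: z) + (- complex.Im k)%:C *: z.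
    rewrite kE scalerDr !scalerA; congr (_ *: _ + _ *: _); first by rewrite mulrC.
    by rewrite mulrAC -expr2 sqrCi mulN1r rmorphN.
  rewrite scalerDr iE kE !phiD !phiZ.
  by apply/eqP; rewrite eq_complex /=; apply/andP; split; apply/eqP; case: (k) => r s /=; ring.
pose F : {scalar A} := HB.pack g (GRing.isLinear.Build _ _ _ _ g glin).
by exists F.
Qed.

Lemma state_attains_norm a : cpos a -> a != 0 ->
  exists2 f : {scalar A}, state f & f a = `|a|.
Proof.
move=> apos a0.
have [phi [lin phile phipos phia]] := dominated_functional apos.
have [f fE] := state_of_real_part lin.
have fle z : `|f z| <= `|z|.
  have [->|fz0] := eqVneq (f z) 0; first by rewrite normr0.
  (* The phase k makes f (k z) = |f z| real, hence equal to phi (k z). *)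
  pose k := `|f z| / f z.
  have kn : `|k| = 1 by rewrite /k normf_div normr_id divff// normr_eq0.
  have : f (k *: z) = `|f z| by rewrite linearZ /= /k divfK.
  have := phile (k *: z); rewrite -lecR -normE normrZ kn mul1r.
  move=> h fk; apply: le_trans h; rewrite -fk fE.
  have : complex.Im (f (k *: z)) = 0 by rewrite fk ger0_Im.
  by rewrite fE /= => ->.
have fa : f a = `|a|.
  by have [_ ia] := phipos a apos; rewrite fE ia oppr0 phia normE.
exists f => //; split.
  move=> b /phipos[b0 ib]; rewrite fE ib oppr0.
  by rewrite (complexr0 (phi b)) ler0c.
split.
  by move=> _ [z /= z1 <-]; apply: le_trans (fle z) z1.
(* The supremum 1 is attained at a / ||a||. *)
move=> M; apply; exists (`|a|^-1 *: a).
  by rewrite /= normrZ normfV normr_id mulVf// normr_eq0.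
by rewrite linearZ /= normrM normfV normr_id fa normr_id mulVf// normr_eq0.
Qed.

Lemma state_le (f : {scalar A}) z : state f -> `|f z| <= `|z|.
Proof.
move=> [_ [fub _]].
have [->|z0] := eqVneq z 0; first by rewrite linear0 normr0.
have n0 : 0 < `|z| by rewrite normr_gt0.
have : `|f (`|z|^-1 *: z)| <= 1.
  apply: fub; exists (`|z|^-1 *: z) => //=.
  by rewrite normrZ normfV normr_id mulVf// normr_eq0.
by rewrite linearZ /= normrM normfV normr_id ler_pdivrMl// mulr1.
Qed.

Lemma state_cpos_le (f : {scalar A}) z : state f -> cpos z -> 0 <= f z <= `|z|.
Proof.
move=> fs zpos; have [fpos _] := fs.
by rewrite fpos//= -[f z]ger0_norm ?fpos// state_le.
Qed.

End States.

(** * Pre-Hilbert modules *)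

Section PreHilbert.
Variables (R : realType) (A : cstarAlgType R) (E : preHilbertType A).
Implicit Types x y : E.

Lemma habs_sqr x : habs x ** habs x = inner x x :> A.
Proof. by have [] := csqrtP (inner_pos x). Qed.

Lemma hnorm_sqr x : hnorm x ^+ 2 = `|inner x x : A|.
Proof.
have [hpos _] := csqrtP (inner_pos x).
by rewrite -habs_sqr /hnorm -normc_starM (cpos_star hpos).
Qed.

Lemma inner_add x y : inner (x + y) (x + y) =
  inner x x + inner y y + (cRe (inner x y) + cRe (inner x y)) :> A.
Proof.
rewrite innerDl !innerDr two_cRe inner_star.
by rewrite [inner y x + _]addrC addrACA.
Qed.

End PreHilbert.

(** * The cycle of implications between the three conditions *)

Theorem theorem3p2 (R : realType) (A : cstarAlgType R)
    (E : preHilbertType A) (x y : E)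
    (hA : exists a : A, a != 0)
    (hxy : cpos (- cRe (inner x y : A))) :
  ((hnorm (x + y)) ^+ 2 = (hnorm x) ^+ 2 + (hnorm y) ^+ 2
    <-> num_range (habs (x + y) ** habs (x + y))
          ((hnorm x) ^+ 2 + (hnorm y) ^+ 2))
  /\
  (num_range (habs (x + y) ** habs (x + y))
     ((hnorm x) ^+ 2 + (hnorm y) ^+ 2)
    <-> exists f : {scalar A},
          (state_at (habs x ** habs x) `&` state_at (habs y ** habs y)) f /\
          f (cRe (inner x y)) = 0).
Proof.
rewrite !habs_sqr !hnorm_sqr.
have attained (a : A) : cpos a -> exists2 f : {scalar A}, state f & f a = `|a|.
  have [->|a0] := eqVneq a 0; last by move=> /state_attains_norm; apply.
  (* For a = 0 any state will do; a nonzero b gives the nonzero positive b^* b, hence a state. *)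
  move=> _; have [b b0] := hA.
  have [||f fs _] := @state_attains_norm _ _ (b^** ** b); first by exists b.
    by rewrite -normr_eq0 normc_starM expf_eq0/= normr_eq0.
  by exists f => //; rewrite linear0 normr0.
have fadd (f : {scalar A}) : f (inner (x + y) (x + y)) =
    f (inner x x) + f (inner y y) + (f (cRe (inner x y)) + f (cRe (inner x y))).
  by rewrite inner_add !linearD.
have fRe (f : {scalar A}) : state f -> f (cRe (inner x y)) <= 0.
  by move=> [/(_ _ hxy) + _]; rewrite linearN oppr_ge0.
have i_ii : `|inner (x + y) (x + y) : A| = `|inner x x : A| + `|inner y y : A| ->
    num_range (inner (x + y) (x + y)) (`|inner x x : A| + `|inner y y : A|).
  by move=> <-; have [f fs fe] := attained _ (inner_pos (x + y)); exists f.
have ii_iii : num_range (inner (x + y) (x + y)) (`|inner x x : A| + `|inner y y : A|) ->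
    exists f : {scalar A},
      (state_at (inner x x) `&` state_at (inner y y)) f /\ f (cRe (inner x y)) = 0.
  move=> [f fs]; rewrite fadd => fE; exists f.
  have /andP[x0 fx] := state_cpos_le fs (inner_pos x).
  have /andP[y0 fy] := state_cpos_le fs (inner_pos y).
  have fr := fRe f fs.
  (* Two nonnegative gaps add up to 2 f(Re<x,y>) <= 0, so all three quantities vanish. *)
  have gapxy : 0 <= (`|inner x x : A| - f (inner x x)) + (`|inner y y : A| - f (inner y y)).
    by rewrite addr_ge0 ?subr_ge0.
  have gapE : (`|inner x x : A| - f (inner x x)) + (`|inner y y : A| - f (inner y y)) =
      f (cRe (inner x y)) + f (cRe (inner x y)).
    by rewrite addrACA -opprD -fE addrC addrA addNr add0r.
  have r0 : f (cRe (inner x y)) = 0.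
    apply/le_anti; rewrite fr/=; move: gapxy; rewrite gapE -mulr2n.
    by rewrite pmulrn_lge0.
  move: gapE; rewrite r0 addr0 => /eqP; rewrite paddr_eq0 ?subr_ge0//.
  rewrite !subr_eq0 => /andP[/eqP ex /eqP ey].
  by split=> //; split; split=> //; rewrite ger0_norm.
have iii_i (f : {scalar A}) :
    (state_at (inner x x) `&` state_at (inner y y)) f -> f (cRe (inner x y)) = 0 ->
    `|inner (x + y) (x + y) : A| = `|inner x x : A| + `|inner y y : A|.
  move=> [[fs fx] [_ fy]] fr; apply/le_anti/andP; split.
    (* The upper bound uses a state g attaining the norm of |x + y|^2; the lower bound uses f. *)
    have [g gs <-] := attained _ (inner_pos (x + y)).
    have /andP[_ gx] := state_cpos_le gs (inner_pos x).
    have /andP[_ gy] := state_cpos_le gs (inner_pos y).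
    rewrite fadd -[leRHS]addr0; apply: lerD; first exact: lerD.
    by rewrite -[leRHS]addr0; apply: lerD; exact: fRe.
  have /andP[x0 _] := state_cpos_le fs (inner_pos x).
  have /andP[y0 _] := state_cpos_le fs (inner_pos y).
  have /andP[_] := state_cpos_le fs (inner_pos (x + y)).
  by rewrite fadd fr !addr0 -fx -fy !ger0_norm.
split; split=> //.
- by move=> /ii_iii[f [fs fr]]; exact: iii_i fs fr.
- by move=> [f [fs fr]]; apply: i_ii; exact: iii_i fs fr.
Qed.
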